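(* Let $G$ be a median graph with basepoint $v_0$. For every vertex $u\in V$, $$\mathrm{ecc}(u)=\max\Big\{\max_{L \text{ POF outgoing from } u}\varphi(u,L),\ \max_{X \text{ POF ingoing to } u}\psi(u,X)\Big\}.$$
   Context: $G=(V,E)$ is a finite, connected, undirected median graph (every triple $x,y,z$ has exactly one vertex $m(x,y,z)$ in $I(x,y)\cap I(y,z)\cap I(z,x)$, with $I(x,y)=\{w: d(x,w)+d(w,y)=d(x,y)\}$); $\mathrm{ecc}(u)=\max_v d(u,v)$. $\Theta$-classes are the classes of the reflexive transitive closure of the relation ''$xy$ and $x'y'$ are opposite edges of a 4-cycle''; each class splits $G$ into two halfspaces. Classes $E_i,E_j$ are orthogonal if some 4-cycle $abcd$ has $ab,cd\in E_i$ and $bc,da\in E_j$; a POF is a set of pairwise orthogonal classes (including the empty set). Edges are oriented away from $v_0$ (from $x$ to $y$ if $d(v_0,x)<d(v_0,y)$). A POF $L$ is outgoing from (resp. ingoing to) $x$ if each class of $L$ has an edge oriented out of (resp. into) $x$. For a POF $L$ outgoing from $x$ there is a unique induced hypercube with basis (vertex closest to $v_0$) $x$ whose edges have exactly the classes of $L$; for a POF $X$ ingoing to $x$ there is a unique induced hypercube with anti-basis (vertex farthest from $v_0$) $x$ whose edges have exactly the classes of $X$. For $x\in I(v_0,y)$, the ladder set $L_{x,y}$ is the set of classes separating $x$ and $y$ with an edge incident to $x$. Milestones: for $x\in I(v_0,y)$, let $x^+$ be the anti-basis of the hypercube with basis $x$ and classes $L_{x,y}$; if $x^+=y$ then $\Pi(x,y)=\{x,y\}$,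 else $\Pi(x,y)=\{x\}\cup\Pi(x^+,y)$; the penultimate milestone $\overline{\pi}(x,y)$ is the element of $\Pi(x,y)\setminus\{y\}$ closest to $y$. Labels: for a POF $L$ outgoing from $u$, $\varphi(u,L)=\max\{d(u,v): u\in I(v_0,v),\ L_{u,v}=L\}$. For a POF $X$ ingoing to $u$, with $u^-$ the basis of the hypercube with anti-basis $u$ and classes $X$, $\psi(u,X)=\max\{d(u,v): m(u,v,v_0)\neq u \text{ and } \overline{\pi}(m(u,v,v_0),u)=u^-\}$. *)

(* Defs.v *)
From mathcomp Require Import all_boot.

Set Implicit Arguments.
Unset Strict Implicit.
Unset Printing Implicit Defensive.

(* A graph is given by its adjacency relation [e] on a finite type [V].       *)
(* An edge is the two-element set of its endpoints, and a Theta-class is the  *)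
(* set of its edges, so a set of classes has type {set {set {set V}}}.        *)
Section Graph.

Variables (V : finType) (e : rel V).

Implicit Types (x y z u v : V) (C D : {set {set V}}).
Implicit Types (L X : {set {set {set V}}}) (Q : {set V}).

(* Length of a shortest walk; it has fewer than #|V| edges if it exists       *)
(* (dist x y = #|V| when x and y are not connected).                          *)
Definition dist x y : nat :=
  find (fun n => [exists p : n.-tuple V, path e x p && (last x p == y)])
       (iota 0 #|V|).

Definition ecc u : nat := \max_v dist u v.

Definition interval x y : {set V} :=
  [set w | dist x w + dist w y == dist x y].

Definition medians x y z : {set V} :=
  interval x y :&: interval y z :&: interval z x.

Definition median_graph : Prop :=
  [/\ symmetric e, irreflexive e, forall x y, connect e x y
    & forall x y z, #|medians x y z| = 1].

(* The default value x is never used in a median graph. *)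
Definition median x y z : V := odflt x [pick w in medians x y z].

Definition four_cycle x y z t : bool := ucycleb e [:: x; y; z; t].

Definition edges : {set {set V}} :=
  [set E : {set V} | [exists x, exists y, e x y && (E == [set x; y])]].

Definition opposite (E F : {set V}) : bool :=
  [exists x, exists y, exists x', exists y',
    [&& four_cycle x y y' x', E == [set x; y] & F == [set x'; y']]].

Definition theta_class (E : {set V}) : {set {set V}} :=
  [set F | connect opposite E F].

Definition theta_classes : {set {set {set V}}} :=
  [set theta_class E | E in edges].

(* x and y lie in different halfspaces of C: the halfspaces are the connected *)
(* components left when the edges of C are removed.                           *)
Definition separates C x y : bool :=
  ~~ connect [rel a b | e a b && ([set a; b] \notin C)] x y.

Definition orthogonal C D : bool :=
  [exists a, exists b, exists c, exists d,
    [&& four_cycle a b c d, [set a; b] \in C, [set c; d] \in C,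
        [set b; c] \in D & [set d; a] \in D]].

Definition is_pof L : bool :=
  (L \subset theta_classes) &&
  [forall C in L, forall D in L, (C != D) ==> orthogonal C D].

(* Q induces a hypercube: it is the image of an isomorphism from the graph on *)
(* the subsets of 'I_k, adjacent when they differ by one element. The bound   *)
(* on k is harmless since k < 2 ^ k = #|Q| <= #|V|.                           *)
Definition is_hypercube Q : bool :=
  [exists k : 'I_#|V|, exists f : {ffun {set 'I_k} -> V},
    [&& injectiveb f, Q == [set f A | A : {set 'I_k}] &
        [forall A, forall B,
          e (f A) (f B) == (#|(A :\: B) :|: (B :\: A)| == 1)]]].

Definition classes_of Q : {set {set {set V}}} :=
  [set theta_class E | E in edges & E \subset Q].

Section Basepoint.

Variable v0 : V.

Definition is_basis Q x : bool :=
  (x \in Q) && [forall y in Q, dist v0 x <= dist v0 y].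

Definition is_antibasis Q x : bool :=
  (x \in Q) && [forall y in Q, dist v0 y <= dist v0 x].

Definition outgoing L x : bool :=
  [forall C in L,
    [exists y, [&& e x y, [set x; y] \in C & dist v0 x < dist v0 y]]].

Definition ingoing X x : bool :=
  [forall C in X,
    [exists y, [&& e y x, [set y; x] \in C & dist v0 y < dist v0 x]]].

Definition hypercube_between x y L : bool :=
  [exists Q : {set V},
    [&& is_hypercube Q, is_basis Q x, is_antibasis Q y & classes_of Q == L]].

(* The default values in the next two definitions are never used when L is a  *)
(* POF outgoing from x, resp. X is a POF ingoing to u, in a median graph.     *)
Definition antibasis_from x L : V :=
  odflt x [pick y | hypercube_between x y L].

Definition basis_into u X : V :=
  odflt u [pick y | hypercube_between y u X].

Definition ladder_set x y : {set {set {set V}}} :=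
  [set C in theta_classes |
    separates C x y && [exists z, e x z && ([set x; z] \in C)]].

Definition next_milestone x y : V := antibasis_from x (ladder_set x y).

(* The recursion is bounded by n: for x in I(v0, y) with x != y, the distance *)
(* to y strictly decreases from x to its next milestone, so that n = dist x y *)
(* steps suffice.                                                             *)
Fixpoint milestones_rec n x y : {set V} :=
  if n is n'.+1 then
    if next_milestone x y == y then [set x; y]
    else x |: milestones_rec n' (next_milestone x y) y
  else [set x; y].

Definition milestones x y : {set V} := milestones_rec (dist x y) x y.

(* Only meaningful for x != y. *)
Definition penultimate_milestone x y : V :=
  [arg min_(z < x in milestones x y :\ y) dist z y].

Definition phi u L : nat :=
  \max_(v | (u \in interval v0 v) && (ladder_set u v == L)) dist u v.

(* The maximum of the empty set is 0; in a median graph, for a POF X ingoing  *)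
(* to u, the range is empty only when X is empty.                             *)
Definition psi u X : nat :=
  \max_(v | (median u v v0 != u) &&
            (penultimate_milestone (median u v v0) u == basis_into u X))
    dist u v.

End Basepoint.

End Graph.

(* Main.v *)
Require Import Defs.
From mathcomp Require Import all_boot zify.

(* Write [sep x y] for the set of Theta-classes separating x and y.  Djokovic's
   argument gives #|sep x y| = d(x, y), and sep x z is the symmetric difference
   of sep x y and sep y z, so intervals, medians and hypercubes are read off
   from separating sets: medians are majorities, and a hypercube with basis x
   and anti-basis y has exactly the classes sep x y.  Joining neighbors of x by
   medians with y yields the hypercube with basis x and classes L_{x,y}, so every
   milestone step gets closer to y and the penultimate milestone p satisfies
   p^+ = y.  A vertex v at distance ecc(u) is then counted by phi(u, L_{u,v}) if
   m = m(u,v,v0) is u, and otherwise by psi(u, L_{p,u}), where p is the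
   penultimate milestone from m to u. *)

Set Implicit Arguments.
Unset Strict Implicit.
Unset Printing Implicit Defensive.

Lemma set2_eq (T : finType) (a b x y : T) :
  [set a; b] = [set x; y] -> (a = x /\ b = y) \/ (a = y /\ b = x).
Proof.
move=> E; have : a \in [set x; y] by rewrite -E set21.
have : b \in [set x; y] by rewrite -E set22.
have : x \in [set a; b] by rewrite E set21.
have : y \in [set a; b] by rewrite E set22.
move=> /set2P + /set2P + /set2P + /set2P.
by do 4!case=> ?; subst; auto.
Qed.

Lemma imset_setD (T U : finType) (f : T -> U) (A B : {set T}) :
  injective f -> f @: (A :\: B) = f @: A :\: f @: B.
Proof.
move=> f_inj; apply/setP=> y; rewrite inE.
apply/imsetP/andP => [[x + ->]|[yB /imsetP[x xA yE]]].
  by rewrite !mem_imset // inE => /andP.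
by exists x => //; rewrite inE xA andbT -(mem_imset B x f_inj) -yE.
Qed.

(** * Shortest walks, intervals and medians *)

Section Graph.

Variables (V : finType) (e : rel V).
Implicit Types (x y z w a b c d : V) (C : {set {set V}}).

Local Notation dist := (dist e).

(** [dist] only searches lengths below [#|V|], so the walk is first shortened to a simple path. *)
Lemma dist_path x p : path e x p -> dist x (last x p) <= size p.
Proof.
case/shortenP => q pq uq sqp; have szq : size q < #|V|.
  by have := card_uniqP uq => /= <-; apply: max_card.
apply: leq_trans (uniq_leq_size _ sqp); last by case/andP: uq.
rewrite leqNgt; apply/negP => lt_q; have := before_find 0 lt_q.
rewrite nth_iota ?add0n // => /existsP[]; exists (in_tuple q).
by rewrite /= pq eqxx.
Qed.

Lemma dist_connect x y : connect e x y ->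
  exists p, [/\ path e x p, last x p = y & size p = dist x y].
Proof.
case/connectP => p /shortenP[q pq uq _] ->; have szq : size q < #|V|.
  by have := card_uniqP uq => /= <-; apply: max_card.
set P := fun n => [exists p : n.-tuple V, path e x p && (last x p == last x q)].
have hP : has P (iota 0 #|V|).
  apply/hasP; exists (size q); first by rewrite mem_iota.
  by apply/existsP; exists (in_tuple q); rewrite /= pq eqxx.
have := nth_find 0 hP; rewrite nth_iota ?add0n; last first.
  by move: hP; rewrite has_find size_iota.
case/existsP => t /andP[pt /eqP lt]; exists t; split=> //.
exact: size_tuple.
Qed.

Hypothesis hG : median_graph e.

Lemma e_sym x y : e x y = e y x. Proof. by case: hG => + _ _ _; apply. Qed.
Lemma e_irr x : e x x = false. Proof. by case: hG => _ + _ _; apply. Qed.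

Lemma geodesic x y : exists p, [/\ path e x p, last x p = y & size p = dist x y].
Proof. by case: hG => _ _ + _ => /(_ x y); apply: dist_connect. Qed.

Lemma dist_lt_card x y : dist x y < #|V|.
Proof.
have [_ _ /(_ x y) /connectP[p pp ->] _] := hG.
case/shortenP: pp => q pq uq _; apply: leq_ltn_trans (dist_path pq) _.
by have := card_uniqP uq => /= <-; apply: max_card.
Qed.

Lemma distxx x : dist x x = 0.
Proof. by have := @dist_path x [::] isT; case: (dist x x). Qed.

Lemma dist_eq0 x y : (dist x y == 0) = (x == y).
Proof.
apply/eqP/eqP => [d0|->]; last exact: distxx.
by have [[|z p] [_ /= lp]] := geodesic x y; rewrite d0.
Qed.

Lemma dist_triangle y x z : dist x z <= dist x y + dist y z.
Proof.
have [p [pp lp <-]] := geodesic x y; have [q [pq lq <-]] := geodesic y z.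
by rewrite -size_cat -lq -lp -last_cat; apply: dist_path; rewrite cat_path pp lp.
Qed.

Lemma dist_sym x y : dist x y = dist y x.
Proof.
suff H a b : dist a b <= dist b a by apply/eqP; rewrite eqn_leq !H.
have [p [pp <- <-]] := geodesic b a.
have := @dist_path (last b p) (rev (belast b p)).
have -> : last (last b p) (rev (belast b p)) = b.
  by case: p {pp} => //= c p; rewrite rev_cons last_rcons.
rewrite size_rev size_belast; apply.
by rewrite rev_path (eq_path (e' := e)) // => c d; exact: e_sym.
Qed.

Lemma dist_edge x y : (dist x y == 1) = e x y.
Proof.
apply/eqP/idP => [d1|exy].
  have [[|z [|t p]] [pp lp sp]] := geodesic x y; rewrite d1 in sp => //.
  by move: pp lp => /= /andP[+ _] <-.
apply/eqP; rewrite eqn_leq (@dist_path x [:: y]) /= ?exy // lt0n dist_eq0.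
by apply: contraTneq exy => ->; rewrite e_irr.
Qed.

Lemma intervalE x y w : (w \in interval e x y) = (dist x w + dist w y == dist x y).
Proof. by rewrite inE. Qed.

Lemma interval_sym x y : interval e x y = interval e y x.
Proof.
by apply/setP => w; rewrite !intervalE addnC (dist_sym w) (dist_sym x y) (dist_sym x w).
Qed.

Lemma median_exists x y z : exists m,
  [/\ m \in interval e x y, m \in interval e y z & m \in interval e z x].
Proof.
have [_ _ _ /(_ x y z) /eqP/cards1P[m mE]] := hG; exists m.
have : m \in medians e x y z by rewrite mE set11.
by rewrite !in_setI => /andP[/andP[-> ->] ->].
Qed.

Lemma median_unique x y z m m' :
  [/\ m \in interval e x y, m \in interval e y z & m \in interval e z x] ->
  [/\ m' \in interval e x y, m' \in interval e y z & m' \in interval e z x] ->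
  m = m'.
Proof.
have [_ _ _ /(_ x y z) /eqP/cards1P[t tE]] := hG => -[h1 h2 h3] [k1 k2 k3].
have : m \in medians e x y z by rewrite !in_setI h1 h2.
have : m' \in medians e x y z by rewrite !in_setI k1 k2.
by rewrite tE !inE => /eqP -> /eqP ->.
Qed.

Lemma median_in x y z :
  [/\ median e x y z \in interval e x y, median e x y z \in interval e y z
    & median e x y z \in interval e z x].
Proof.
rewrite /median; case: pickP => [m|no] /=.
  by rewrite !in_setI => /andP[/andP[-> ->] ->].
have [m [h1 h2 h3]] := median_exists x y z.
by have := no m; rewrite !in_setI h1 h2 h3.
Qed.

(** * Bipartiteness and halfspaces *)

Lemma dist_neighbors w x y : e x y ->
  dist w x = (dist w y).+1 \/ dist w y = (dist w x).+1.
Proof.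
(* This median is an endpoint of the edge, and it lies on a geodesic from [w] to the other
   endpoint. *)
rewrite -dist_edge => /eqP xy; have [m []] := median_exists w x y.
rewrite !intervalE (dist_sym x m) (dist_sym y m) (dist_sym y w) (dist_sym m w) xy.
move=> /eqP h1 /eqP h2 /eqP h3.
case: (posnP (dist m x)) => [/eqP|mx]; first rewrite dist_eq0 => /eqP ?; last first.
  have /eqP : dist m y = 0 by lia.
  by rewrite dist_eq0 => /eqP ?; subst m; rewrite -h1 (dist_sym y x) xy; lia.
by subst m; rewrite -h3 xy; lia.
Qed.

(** For an edge [ab] this is the halfspace on the side of [a]; by bipartiteness the side of [b] is
    its complement. *)
Definition closer a b w := dist w a < dist w b.

Lemma closerN a b w : e a b -> closer b a w = ~~ closer a b w.
Proof. by move=> /(dist_neighbors w); rewrite /closer; lia. Qed.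

Lemma closer_left a b : e a b -> closer a b a.
Proof. by rewrite -dist_edge /closer distxx => /eqP ->. Qed.

Lemma closer_right a b : e a b -> closer a b b = false.
Proof. by rewrite /closer distxx ltn0. Qed.

(** * Squares and opposite edges *)

Lemma four_cycleE a b c d : four_cycle e a b c d =
  [&& e a b, e b c, e c d, e d a, a != c & b != d].
Proof.
rewrite /four_cycle /ucycleb /= !inE !andbT !negb_or.
case eab: (e a b); case ebc : (e b c); case ecd : (e c d); case eda: (e d a); rewrite //=.
have neq u v : e u v -> u != v by move=> uv; apply: contraTneq uv => ->; rewrite e_irr.
by rewrite (neq a b) // (neq b c) // (neq c d) // (eq_sym a d) (neq d a) // !andbT.
Qed.

Lemma dist2 a b c : e a b -> e b c -> a != c -> dist a c = 2.
Proof.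
move=> ab bc; rewrite -dist_eq0; have := dist_neighbors a bc.
by move: ab; rewrite -dist_edge => /eqP ->; lia.
Qed.

(* Otherwise a vertex m completes the square to a K_{2,3}, in which the three
   vertices m, b, c have the two medians a and d. *)
Lemma closer_square_sub a b d c w :
  four_cycle e a b d c -> closer a b w -> closer c d w.
Proof.
rewrite four_cycleE => /and5P[ab bd dc ca /andP[nad nbc]] wab.
apply: contraT => wcd; have {wcd} wdc : closer d c w by rewrite (closerN w _) // e_sym.
have [m [m1 m2 m3]] := median_exists a d w.
have ad : dist a d = 2 by apply: dist2 ab bd nad.
have hb := dist_neighbors w ab; have hc := dist_neighbors w ca.
have hbd := dist_neighbors w bd.
move: wab wdc; rewrite /closer => wab wdc.
move: m1 m2 m3; rewrite !intervalE ad (dist_sym d m) (dist_sym m w) (dist_sym d w).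
rewrite (dist_sym a m) => /eqP m1 /eqP m2 /eqP m3.
have am : e a m by rewrite e_sym -dist_edge; lia.
have dm : e d m by rewrite e_sym -dist_edge; lia.
have nmb : b != m by apply/eqP => E; subst m; lia.
have nmc : c != m by apply/eqP => E; subst m; lia.
have ba : e b a by rewrite e_sym.
have db : e d b by rewrite e_sym.
have ac : e a c by rewrite e_sym.
have cd : e c d by rewrite e_sym.
have ma : e m a by rewrite e_sym.
have md : e m d by rewrite e_sym.
suff E : a = d by rewrite E eqxx in nad.
have bc2 := dist2 ba ac nbc; have mb2 := dist2 ba am nmb; have mc2 := dist2 ca am nmc.
move: ba db ac cd ma md ab bd ca dc am dm; rewrite -!dist_edge.
do 12 move=> /eqP ?.
apply: (@median_unique b c m); rewrite !intervalE bc2 mc2 (dist_sym m b) mb2; split; lia.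
Qed.

Lemma four_cycle_flip a b d c : four_cycle e a b d c -> four_cycle e c d b a.
Proof.
rewrite !four_cycleE => /and5P[ab bd dc ca /andP[nad nbc]].
rewrite (e_sym c d) (e_sym d b) (e_sym b a) (e_sym a c) ab bd dc ca.
by rewrite (eq_sym c) (eq_sym d) nad nbc.
Qed.

Lemma closer_square a b d c : four_cycle e a b d c -> closer a b =1 closer c d.
Proof.
move=> cyc w; apply/idP/idP; apply: closer_square_sub => //.
exact: four_cycle_flip.
Qed.

(** [connect] is only a reflexive transitive closure; symmetry makes the Theta-classes the blocks of
    an equivalence relation. *)
Lemma opposite_sym : symmetric (opposite e).
Proof.
suff H E F : opposite e E F -> opposite e F E by move=> E F; apply/idP/idP; apply: H.
case/existsP=> x /existsP[y /existsP[x' /existsP[y' /and3P[cyc EE EF]]]].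
apply/existsP; exists x'; apply/existsP; exists y'; apply/existsP; exists x.
by apply/existsP; exists y; rewrite (four_cycle_flip cyc) EE EF.
Qed.

Lemma opposite_square a b d c : four_cycle e a b d c ->
  opposite e [set a; b] [set c; d].
Proof.
move=> cyc; apply/existsP; exists a; apply/existsP; exists b.
by apply/existsP; exists c; apply/existsP; exists d; rewrite cyc !eqxx.
Qed.

Lemma opposite_edge a b F : opposite e [set a; b] F ->
  exists c d, F = [set c; d] /\ four_cycle e a b d c.
Proof.
case/existsP=> x /existsP[y /existsP[x' /existsP[y' /and3P[cyc /eqP EE /eqP ->]]]].
case: (set2_eq EE) => -[-> ->]; first by exists x', y'.
exists y', x'; split; first exact: setUC.
move: cyc; rewrite !four_cycleE => /and5P[h1 h2 h3 h4 /andP[h5 h6]].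
by rewrite (e_sym y x) (e_sym x x') (e_sym x' y') (e_sym y' y) h1 h2 h3 h4 h5 h6.
Qed.

(** * Theta-classes as cuts between halfspaces *)

Lemma theta_class_eq E F : F \in theta_class e E -> theta_class e E = theta_class e F.
Proof.
rewrite inE => EF; apply/setP => H; rewrite !inE.
exact: (same_connect (sym_connect_sym opposite_sym) EF H).
Qed.


Lemma theta_class_in E : E \in theta_class e E.
Proof. by rewrite inE connect0. Qed.

Lemma theta_class_edge a b : e a b -> theta_class e [set a; b] \in theta_classes e.
Proof.
move=> ab; apply: imset_f; rewrite inE.
by apply/existsP; exists a; apply/existsP; exists b; rewrite ab eqxx.
Qed.

Lemma theta_classesP C : reflect
  (exists a b, e a b /\ C = theta_class e [set a; b]) (C \in theta_classes e).
Proof.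
apply: (iffP imsetP) => [[E]|[a [b [ab ->]]]]; last first.
  exists [set a; b] => //; rewrite inE.
  by apply/existsP; exists a; apply/existsP; exists b; rewrite ab eqxx.
rewrite inE => /existsP[a /existsP[b /andP[ab /eqP ->]]] ->.
by exists a, b.
Qed.

(** Opposite edges of a square define the same halfspaces, hence so do the two ends of a chain of
    squares, once suitably oriented. *)
Lemma theta_class_closer a b F : e a b -> F \in theta_class e [set a; b] ->
  exists c d, [/\ F = [set c; d], e c d & closer c d =1 closer a b].
Proof.
move=> ab; rewrite inE => /connectP[p + ->] {F}.
elim: p a b ab => [|G p IH] a b ab /=; first by exists a, b.
case/andP=> /opposite_edge[c [d [-> cyc]]] pp.
have cd : e c d by move: cyc; rewrite four_cycleE => /and5P[_ _ + _ _]; rewrite e_sym.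
have [c' [d' [-> c'd' h]]] := IH _ _ cd pp.
by exists c', d'; split=> // w; rewrite h (closer_square cyc).
Qed.

(* Djokovic's argument: slide [cd] across squares towards [ab]. *)
Lemma closer_theta_class a b c d : e a b -> e c d ->
  closer a b c -> ~~ closer a b d -> [set c; d] \in theta_class e [set a; b].
Proof.
move=> ab; rewrite inE; move Dn : (dist c a) => n.
elim: n c d Dn => [|n IH] c d Dn cd sc sd.
  have E : c = a by apply/eqP; rewrite -dist_eq0 Dn.
  subst c; suff -> : d = b by apply: connect0.
  apply/eqP; rewrite -dist_eq0; have := dist_neighbors d ab.
  by move: sd cd; rewrite /closer -dist_edge (dist_sym a d) => sd /eqP da; lia.
have [[|c' p] [/= pp lp sp]] := geodesic c a; rewrite Dn in sp => //.
case/andP: pp => cc' pp; have Dc' : dist c' a = n.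
  have : dist c' a <= size p by rewrite -lp dist_path.
  have := dist_triangle c' c a; rewrite Dn; move: cc'; rewrite -dist_edge => /eqP ->.
  by case: sp => ->; lia.
have hc := dist_neighbors c ab; have hd := dist_neighbors d ab.
have hc' := dist_neighbors c' ab.
have tb := dist_triangle c' c b.
have tda := dist_triangle c d a; have tdb := dist_triangle d c b.
move: sc sd tb tda tdb; rewrite /closer => sc sd.
have [c'c dc] : e c' c /\ e d c by rewrite !(e_sym _ c).
have [d1 d2 d3 d4] : [/\ dist c c' = 1, dist c d = 1, dist c' c = 1 & dist d c = 1].
  by split; apply/eqP; rewrite dist_edge.
rewrite d1 d2 d4 => tb tda tdb.
have Ncd : c' != d by apply/eqP=> E; subst d; lia.
have c'd : dist c' d = 2 := dist2 c'c cd Ncd.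
(* Both [c'] and [d] are at distance [n.+1] from [b], so this median is the fourth corner of a
   square with [c'], [c], [d], one step closer to [b]. *)
have [m []] := median_exists c' d b.
rewrite !intervalE c'd (dist_sym b c') (dist_sym d m) (dist_sym b m) (dist_sym m c').
move=> /eqP m1 /eqP m2 /eqP m3.
have c'm : e c' m by rewrite -dist_edge; lia.
have md : e m d by rewrite -dist_edge; lia.
have hm := dist_neighbors m ab.
have tm := dist_triangle m d a; have tm' := dist_triangle m c' a.
have cyc : four_cycle e c' m d c.
  rewrite four_cycleE c'm md dc cc' Ncd /=.
  by apply/eqP=> E; subst m; lia.
have := opposite_square cyc => op.
apply: connect_trans (IH c' m Dc' c'm _ _) (connect1 op); first by rewrite /closer; lia.
have md1 : dist m d = 1 by apply/eqP; rewrite dist_edge.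
have tm2 := dist_triangle d m a; have dm1 : dist d m = 1 by rewrite dist_sym.
by rewrite /closer; lia.
Qed.

(** All edges of a class share its halfspaces, so each crosses from one to the other; conversely,
    Djokovic's argument applies to a crossing edge in one of its two orientations. *)
Lemma theta_class_crossing a b c d : e a b -> e c d ->
  ([set c; d] \in theta_class e [set a; b]) = (closer a b c != closer a b d).
Proof.
move=> ab cd; apply/idP/idP => [H|].
  have [c' [d' [E c'd' h]]] := theta_class_closer ab H; rewrite -!h.
  case: (set2_eq E) => -[-> ->]; first by rewrite closer_left // closer_right.
  by rewrite closer_left // closer_right.
case sc: (closer a b c); case sd : (closer a b d) => // _.
  by apply: closer_theta_class; rewrite ?sc ?sd.
by rewrite setUC; apply: closer_theta_class; rewrite ?sc ?sd // e_sym.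
Qed.

(** Drives the inductions along geodesics: the remaining path is shorter from [b], so the end lies
    across the first edge, in the same halfspace as [b]. *)
Lemma closer_geodesic a b p : path e a (b :: p) ->
  dist a (last b p) = (size p).+1 -> closer b a (last b p).
Proof.
rewrite /closer => /= /andP[ab pp] d1; rewrite !(dist_sym (last b p)) d1 ltnS.
exact: dist_path.
Qed.

(** A walk avoiding the class never changes side. Conversely, a geodesic between two vertices on one
    side avoids the class: were its first edge in the class, its end would lie on the other side. *)
Lemma separatesE a b x y : e a b ->
  separates e (theta_class e [set a; b]) x y = (closer a b x != closer a b y).
Proof.
move=> ab; rewrite /separates -[RHS]negbK; congr (~~ _).
apply/idP/negPn => [/connectP[p + ->]|/eqP].
  elim: p x => //= z p IH x /andP[/andP[xz] + /IH/eqP <-].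
  by rewrite theta_class_crossing // negbK.
have [p [+ <- ]] := geodesic x y.
elim: p x => [|z p IH] x; first by rewrite connect0.
move=> pp d1 sx; have := closer_geodesic pp (esym d1).
case/andP: (pp) => xz pz sz.
have xzC : [set x; z] \notin theta_class e [set a; b].
  apply/negP => H; have [c [d [E cd h]]] := theta_class_closer ab H.
  move: sx; rewrite -!h /=; have dc : e d c by rewrite e_sym.
  case: (set2_eq E) => -[E1 E2]; subst.
    by rewrite closer_left // closerN // sz.
  by rewrite closer_right // sz.
apply: connect_trans (connect1 _) (IH z pz _ _); first by rewrite /= xz.
  have := dist_path pz; have := dist_triangle z x (last z p).
  move: d1 xz; rewrite -dist_edge /= => <- /eqP ->; lia.
move: xzC; rewrite theta_class_crossing // negbK => /eqP <-.
exact: sx.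
Qed.

(** A class has only two sides, so separation adds up modulo 2. *)
Lemma separates_trans C y x z : C \in theta_classes e ->
  separates e C x z = separates e C x y (+) separates e C y z.
Proof.
case/theta_classesP=> a [b [ab ->]]; rewrite !separatesE //.
by do 3!case: closer.
Qed.

Lemma separatesxx C x : separates e C x x = false.
Proof. by rewrite /separates connect0. Qed.

Lemma separates_sym C x y : C \in theta_classes e ->
  separates e C x y = separates e C y x.
Proof. by move=> /(separates_trans y x x); rewrite separatesxx; do 2!case: separates. Qed.

Lemma separates_edge C x y : C \in theta_classes e -> e x y ->
  separates e C x y = (C == theta_class e [set x; y]).
Proof.
case/theta_classesP=> a [b [ab ->]] xy; rewrite separatesE // -theta_class_crossing //.
apply/idP/eqP => [/theta_class_eq //|->]; exact: theta_class_in.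
Qed.

Lemma edge_class C x y : C \in theta_classes e ->
  ([set x; y] \in C) = (C == theta_class e [set x; y]).
Proof.
case/theta_classesP=> a [b [ab ->]].
apply/idP/eqP => [/theta_class_eq //|->]; exact: theta_class_in.
Qed.

(** * Separating sets: distances, intervals and medians *)

Definition sep x y := [set C in theta_classes e | separates e C x y].

Lemma in_sep C x y : (C \in sep x y) = (C \in theta_classes e) && separates e C x y.
Proof. by rewrite inE. Qed.

Lemma sepE y x z C : (C \in sep x z) = (C \in sep x y) (+) (C \in sep y z).
Proof. by rewrite !inE; case Cth : (C \in _) => //=; apply: separates_trans. Qed.

Lemma sepxx x : sep x x = set0.
Proof. by apply/setP=> C; rewrite !inE separatesxx andbF. Qed.

Lemma sep_sym x y : sep x y = sep y x.
Proof.
by apply/setP=> C; rewrite !inE; case Cth : (C \in _) => //=; apply: separates_sym.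
Qed.

Lemma sep_edge x y : e x y -> sep x y = [set theta_class e [set x; y]].
Proof.
move=> xy; apply/setP=> C; rewrite !inE; case Cth : (C \in _) => /=.
  exact: separates_edge.
by apply/esym/eqP => E; rewrite E theta_class_edge in Cth.
Qed.

(** Each edge of a geodesic contributes a new class, because the class of the first edge does not
    separate [z] from the end. *)
Lemma card_sep x y : #|sep x y| = dist x y.
Proof.
have [p [+ <-]] := geodesic x y.
elim: p x => [|z p IH] x; first by rewrite sepxx cards0.
move=> pp d1; case/andP: (pp) => xz pz; have := closer_geodesic pp (esym d1).
have dz : size p = dist z (last z p).
  have := dist_path pz; have := dist_triangle z x (last z p).
  by move: d1 xz; rewrite -dist_edge /= => <- /eqP ->; lia.
move=> /= sz; have NC : theta_class e [set x; z] \notin sep z (last z p).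
  by rewrite !inE separatesE // closer_right // (closerN _ _) 1?e_sym // sz andbF.
have -> : sep x (last z p) = theta_class e [set x; z] |: sep z (last z p).
  apply/setP=> C; rewrite (sepE z) sep_edge // in_setU1 in_set1.
  by case: eqP => //= ->; rewrite (negPf NC).
by rewrite cardsU1 NC IH // -dz; exact: d1.
Qed.

Lemma sep_eq0 x y : (sep x y == set0) = (x == y).
Proof. by rewrite -cards_eq0 card_sep dist_eq0. Qed.

(** As [sep x y] is the symmetric difference of the other two sets, its cardinal is the sum of
    theirs exactly when they do not overlap. *)
Lemma interval_disjoint x y w : (w \in interval e x y) = [disjoint sep x w & sep w y].
Proof.
have E : sep x y = (sep x w :|: sep w y) :\: (sep x w :&: sep w y).
  by apply/setP=> C; rewrite (sepE w) !inE; do 2!case: (_ && separates _ _ _ _).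
rewrite intervalE -!card_sep E cardsD.
have := subset_leq_card (subsetIl (sep x w) (sep w y)).
have := cardsUI (sep x w) (sep w y).
rewrite -setI_eq0 -cards_eq0.
set I := sep x w :&: sep w y; set U := sep x w :|: sep w y.
have -> : U :&: I = I by apply/setIidPr/(subset_trans (subsetIl _ _))/subsetUl.
have IU : I \subset U := subset_trans (subsetIl _ _) (subsetUl _ _).
by have := subset_leq_card IU; lia.
Qed.

Lemma interval_sub x y w : (w \in interval e x y) = (sep x w \subset sep x y).
Proof.
rewrite interval_disjoint; apply/idP/idP => [/disjoint_setI0/setP D|/subsetP D].
  by apply/subsetP=> C Cw; have := D C; rewrite (sepE w) !in_setI Cw in_set0 /= => ->.
rewrite -setI_eq0; apply/eqP/setP=> C; rewrite in_setI in_set0.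
by case Cw : (C \in sep x w) => //=; have := D _ Cw; rewrite (sepE w) Cw; case: (C \in _).
Qed.


(** When two of [x], [y], [z] lie on one side of [C], so does [m], being in their interval: [m]
    follows the majority. *)
Lemma median_sep C x y z m :
  [/\ m \in interval e x y, m \in interval e y z & m \in interval e z x] ->
  C \in sep x m = (C \in sep x y) && (C \in sep x z).
Proof.
rewrite !interval_sub => -[/subsetP /(_ C) + /subsetP /(_ C) + /subsetP /(_ C)].
rewrite (sepE x y m) (sepE x y z) (sepE x z m) (sep_sym y x) (sep_sym z x).
case: (C \in sep x m); case: (C \in sep x y); case: (C \in sep x z) => // m1 m2 m3;
  first [by move: (m1 isT) | by move: (m2 isT) | by move: (m3 isT)].
Qed.

Local Notation symdiff A B := ((A :\: B) :|: (B :\: A)).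

Lemma in_symdiff (T : finType) (A B : {set T}) i :
  (i \in symdiff A B) = (i \in A) (+) (i \in B).
Proof. by rewrite !inE; do 2!case: (_ \in _). Qed.

Lemma sep_symdiff x y z : sep y z = symdiff (sep x y) (sep x z).
Proof. by apply/setP=> C; rewrite in_symdiff (sep_sym x y) -sepE. Qed.

(** * Classes of a hypercube *)

Section Cube.

Variables (k : nat) (f : {set 'I_k} -> V).
Implicit Types (A B D : {set 'I_k}) (i j : 'I_k).
Hypothesis f_inj : injective f.
Hypothesis f_edge : forall A B, e (f A) (f B) = (#|symdiff A B| == 1).

(** The class of direction [i], read off at the corner [f set0]; [cube_edge_class] shows that every
    parallel edge gives the same class. *)
Definition cube_class i := theta_class e [set f set0; f [set i]].

Lemma cube_edgeU1 A i : i \notin A -> e (f A) (f (i |: A)).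
Proof.
move=> iA; rewrite f_edge; apply/cards1P; exists i; apply/setP=> j.
by rewrite in_symdiff !inE; case: eqP => //= [->|_]; [rewrite (negPf iA)|case: (_ \in _)].
Qed.

Lemma cube_edge_class A i : i \notin A ->
  theta_class e [set f A; f (i |: A)] = cube_class i.
Proof.
move Dn : #|A| => n; elim: n A Dn => [|n IH] A Dn iA.
  by rewrite (cards0_eq Dn) setU0.
(* Any [j] in [A] yields the square at [A :\ j] with directions [i] and [j], where the [i]-edges at
   [A] and at [A :\ j] are opposite. *)
have [j jA] : exists j, j \in A by apply/set0Pn; rewrite -card_gt0 Dn.
have iB : i \notin A :\ j by rewrite !inE (negPf iA) andbF.
have nij : j != i by apply: contraNneq iA => <-.
rewrite -(IH (A :\ j)) //; last by move: Dn; rewrite (cardsD1 j) jA => -[].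
apply/esym/theta_class_eq; rewrite inE; apply/connect1/opposite_square.
have EA : j |: (A :\ j) = A by rewrite setD1K.
have EB : j |: (i |: A :\ j) = i |: A by rewrite setUCA EA.
rewrite four_cycleE cube_edgeU1 //= -{1}EB cube_edgeU1; last first.
  by rewrite !inE eqxx (negPf nij).
rewrite e_sym cube_edgeU1 //= e_sym -{2}EA cube_edgeU1 ?(inE, eqxx) //=.
apply/andP; split; apply/eqP => /f_inj /setP /(_ i);
  by rewrite !inE eqxx (negPf iA) ?andbF.
Qed.

Lemma sep_cubeU1 A i : i \notin A -> sep (f A) (f (i |: A)) = [set cube_class i].
Proof. by move=> iA; rewrite sep_edge ?cube_edge_class // cube_edgeU1. Qed.

(** Neighbors of [f set0] in two directions of the same class would be separated by no class, hence
    equal, against injectivity of [f]. *)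
Lemma cube_class_inj : injective cube_class.
Proof.
move=> i j ij; have h l : sep (f set0) (f [set l]) = [set cube_class l].
  by rewrite -(@sep_cubeU1 set0) ?inE // setU0.
apply/set1P; suff /f_inj <- : f [set i] = f [set j] by apply: set11.
apply/eqP; rewrite -sep_eq0 (sep_symdiff (f set0)) !h ij.
by rewrite setDv setU0.
Qed.

Lemma sep_cube A B : sep (f A) (f B) = cube_class @: symdiff A B.
Proof.
(* From the corner [f set0] each added direction contributes a new class, by [cube_class_inj]; two
   arbitrary vertices are then compared through this corner. *)
have H D : sep (f set0) (f D) = cube_class @: D.
  move Dn : #|D| => n; elim: n D Dn => [|n IH] D Dn.
    by rewrite (cards0_eq Dn) sepxx imset0.
  have [j jD] : exists j, j \in D by apply/set0Pn; rewrite -card_gt0 Dn.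
  rewrite -(setD1K jD) imsetU1; apply/setP=> C.
  rewrite (sepE (f (D :\ j))) (sep_cubeU1 (negbT (setD11 _ _))) in_set1 in_setU1 IH; last first.
    by move: Dn; rewrite (cardsD1 j) jD => -[].
  case: eqP => //= [->|_]; last by rewrite addbF.
  by rewrite mem_imset ?inE ?eqxx //; apply: cube_class_inj.
rewrite (sep_symdiff (f set0)) !H imsetU.
by rewrite !imset_setD //; apply: cube_class_inj.
Qed.


Lemma classes_of_cube :
  classes_of e [set f A | A : {set 'I_k}] = [set cube_class i | i : 'I_k].
Proof.
apply/setP=> C; apply/imsetP/imsetP => [[E]|[i _ ->]]; last first.
  have ei : e (f set0) (f [set i]) by rewrite -(setU0 [set i]) cube_edgeU1 ?inE.
  exists [set f set0; f [set i]] => //; rewrite !inE; apply/andP; split.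
    by apply/existsP; exists (f set0); apply/existsP; exists (f [set i]); rewrite ei eqxx.
  by apply/subsetP=> w /set2P[] ->; apply: imset_f.
rewrite !inE => /andP[/existsP[x /existsP[y /andP[xy /eqP ->]]] sub ->].
have /imsetP[A _ xA] := subsetP sub x (set21 _ _).
have /imsetP[B _ yB] := subsetP sub y (set22 _ _).
have := sep_edge xy; rewrite xA yB sep_cube => EC.
have : theta_class e [set f A; f B] \in cube_class @: symdiff A B by rewrite EC set11.
by case/imsetP=> i _ ->; exists i.
Qed.

Lemma cube_toggle A i : exists B, symdiff A B = [set i].
Proof.
exists (symdiff A [set i]); apply/setP=> j; rewrite !in_symdiff.
by case: (j \in A); case: (j \in [set i]).
Qed.

Lemma sep_toggle w A B i : symdiff A B = [set i] ->
  sep w (f B) = symdiff (sep w (f A)) [set cube_class i].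
Proof.
move=> AB; by apply/setP=> C; rewrite in_symdiff (sepE (f A)) sep_cube AB imset_set1.
Qed.

(** Otherwise flipping coordinate [i] would remove a separating class and give a vertex of the cube
    closer to [w]. *)
Lemma basis_notin_sep w A i : is_basis e w [set f A | A : {set 'I_k}] (f A) ->
  cube_class i \notin sep w (f A).
Proof.
case/andP=> _ /forall_inP min; apply/negP => iA; have [B AB] := cube_toggle A i.
have := min (f B) (imset_f _ isT).
rewrite -!card_sep (sep_toggle _ AB) leqNgt => /negP; apply.
have -> : symdiff (sep w (f A)) [set cube_class i] = sep w (f A) :\ cube_class i.
  apply/setP=> C; rewrite in_symdiff in_setD1 in_set1.
  by case: eqP => [->|]; rewrite ?iA ?addbF.
by rewrite [X in _ < X](cardsD1 (cube_class i)) iA.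
Qed.

Lemma antibasis_in_sep w A i : is_antibasis e w [set f A | A : {set 'I_k}] (f A) ->
  cube_class i \in sep w (f A).
Proof.
case/andP=> _ /forall_inP max; apply/negPn/negP => iA; have [B AB] := cube_toggle A i.
have := max (f B) (imset_f _ isT).
rewrite -!card_sep (sep_toggle _ AB) leqNgt => /negP; apply.
have -> : symdiff (sep w (f A)) [set cube_class i] = cube_class i |: sep w (f A).
  apply/setP=> C; rewrite in_symdiff in_setU1 in_set1.
  by case: eqP => [->|]; rewrite ?(negPf iA) ?addbF.
by rewrite cardsU1 iA.
Qed.

End Cube.

(** Every class of the cube has the basis on the side of [v0] and the anti-basis on the other side,
    so exactly these classes separate the two. The last clause gives the edges of the cube that
    enter the anti-basis. *)
Lemma hypercube_between_sep v0 x y L : hypercube_between e v0 x y L ->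
  [/\ sep x y = L, x \in interval e v0 y &
      forall C, C \in L -> exists z,
        [/\ e z y, [set z; y] \in C & dist v0 z < dist v0 y]].
Proof.
case/existsP=> Q /and4P[/existsP[k /existsP[f /and3P[]]]].
move=> /injectiveP f_inj /eqP -> /forallP fe.
have {}fe A B : e (f A) (f B) = (#|symdiff A B| == 1).
  by have /forallP /(_ B) /eqP := fe A.
move=> basis antibasis; rewrite classes_of_cube // => /eqP <-.
case/andP: (basis) (basis) => /imsetP[A _ ->] _ basisA.
case/andP: (antibasis) (antibasis) => /imsetP[B _ ->] _ antiB.
have nA i := basis_notin_sep f_inj fe i basisA.
have iB i := antibasis_in_sep f_inj fe i antiB.
have E : sep (f A) (f B) = [set cube_class f i | i : 'I_k].
  apply/eqP; rewrite eqEsubset; apply/andP; split.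
    by rewrite sep_cube //; apply: imsetS; apply/subsetP.
  by apply/subsetP=> C /imsetP[i _ ->]; rewrite (sepE v0) sep_sym (negPf (nA i)) iB.
split=> //; first rewrite interval_disjoint E.
  rewrite disjoint_sym; apply/pred0P => C /=; apply/negP => /andP[/imsetP[i _ ->]].
  exact/negP.
move=> C /imsetP[i _ ->]; have [D BD] := cube_toggle B i.
have DB : e (f D) (f B) by rewrite e_sym fe BD cards1.
exists (f D); split=> //.
  rewrite edge_class; first rewrite -in_set1 -sep_edge //.
    by rewrite sep_sym sep_cube // BD imset_set1 set11.
  by have := iB i; rewrite in_sep => /andP[].
rewrite ltn_neqAle; case/andP: antiB => _ /forall_inP ->; last exact: imset_f.
by case: (dist_neighbors v0 DB) => ->; rewrite andbT neq_ltn ltnSn ?orbT.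
Qed.

(** A vertex is determined by the classes separating it from [y]; hence the choice made by [pick] in
    [basis_into] is forced. *)
Lemma hypercube_between_basis_inj v0 x x' y L :
  hypercube_between e v0 x y L -> hypercube_between e v0 x' y L -> x = x'.
Proof.
case/hypercube_between_sep => E _ _ /hypercube_between_sep[E' _ _].
by apply/eqP; rewrite -sep_eq0 (sep_symdiff y) !(sep_sym y) E E' setDv setU0.
Qed.

(** * Ladder sets and their hypercubes *)

Lemma ladder_edge x y C : C \in ladder_set e x y -> exists2 z, e x z & sep x z = [set C].
Proof.
rewrite inE => /and3P[Cth _ /existsP[z /andP[xz]]]; rewrite edge_class // => /eqP ->.
by exists z => //; apply: sep_edge.
Qed.

Lemma ladder_sub x y : ladder_set e x y \subset sep x y.
Proof. by apply/subsetP=> C; rewrite !inE => /and3P[-> ->]. Qed.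

(* The vertex for [C |: A] is the join of those for [A] and [C] in the lattice
   I(x, y), whose join is the median with [y]. *)
Lemma ladder_vertex x y (A : {set {set {set V}}}) : A \subset ladder_set e x y ->
  exists w, sep x w = A.
Proof.
move Dn : #|A| => n; elim: n A Dn => [|n IH] A Dn AL.
  by exists x; rewrite (cards0_eq Dn) sepxx.
have [C CA] : exists C, C \in A by apply/set0Pn; rewrite -card_gt0 Dn.
have [w wE] : exists w, sep x w = A :\ C.
  apply: IH; first by move: Dn; rewrite (cardsD1 C) CA => -[].
  exact: subset_trans (subsetDl _ _) AL.
have [z xz zE] := ladder_edge (subsetP AL C CA).
have Ay : A \subset sep x y := subset_trans AL (ladder_sub x y).
have [m hm] := median_exists w z y; exists m; apply/setP=> D.
rewrite (sepE w) (median_sep D hm) (sepE x w z) (sepE x w y) (sep_sym w x) wE zE in_setD1 in_set1.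
case: eqP => [->|_] /=; first by rewrite CA (subsetP Ay C CA).
by case AD : (D \in A) => //; rewrite (subsetP Ay D AD).
Qed.

Lemma ladder_pof x y : is_pof e (ladder_set e x y).
Proof.
apply/andP; split; first by apply/subsetP=> C; rewrite inE => /andP[].
apply/forall_inP=> C CL; apply/forall_inP=> D DL; apply/implyP=> nCD.
have [z xz zE] := ladder_edge CL; have [t xt tE] := ladder_edge DL.
(* The vertex across both classes closes the square [x z w t], whose edges have classes [C], [D],
   [C], [D] in turn. *)
have [w wE] : exists w, sep x w = [set C; D].
  by apply: (ladder_vertex (y := y)); apply/subsetP=> B /set2P[] ->.
have zw_eq : sep z w = [set D].
  apply/setP=> B; rewrite (sepE x) (sep_sym z x) zE wE !inE.
  by case: eqP => [->|]; rewrite ?(negPf nCD).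
have wt_eq : sep w t = [set C].
  apply/setP=> B; rewrite (sepE x) (sep_sym w x) tE wE !inE orbC.
  by case: eqP => [->|]; rewrite ?(eq_sym D) ?(negPf nCD) ?addbF.
have zw : e z w by rewrite -dist_edge -card_sep zw_eq cards1.
have wt : e w t by rewrite -dist_edge -card_sep wt_eq cards1.
have in_class a b B : e a b -> sep a b = [set B] -> [set a; b] \in B.
  by move=> ab; rewrite sep_edge // => /set1_inj <-; apply: theta_class_in.
apply/existsP; exists x; apply/existsP; exists z; apply/existsP; exists w.
apply/existsP; exists t; rewrite !in_class // 1?e_sym // 1?sep_sym //.
rewrite four_cycleE xz zw wt e_sym xt -!sep_eq0 wE /= !andbT; apply/andP; split.
  by apply/set0Pn; exists C; rewrite set21.
by apply/set0Pn; exists C; rewrite (sepE x) (sep_sym z x) zE tE !inE eqxx (negPf nCD).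
Qed.

Lemma interval_disjoint_notin v0 x y C : x \in interval e v0 y -> C \in sep x y ->
  C \notin sep v0 x.
Proof.
by rewrite interval_disjoint => /disjointFl xy /xy ->.
Qed.

(** A ladder class separates [x] from [y], hence not [v0] from [x], as [x] is between them; crossing
    it from [x] therefore moves away from [v0]. *)
Lemma ladder_outgoing v0 x y : x \in interval e v0 y ->
  outgoing e v0 (ladder_set e x y) x.
Proof.
move=> xI; apply/forall_inP=> C CL; have [z xz zE] := ladder_edge CL.
apply/existsP; exists z; rewrite xz /=; apply/andP; split.
  by move: zE; rewrite sep_edge // => /set1_inj <-; apply: theta_class_in.
have Cv := interval_disjoint_notin xI (subsetP (ladder_sub x y) C CL).
suff -> : dist v0 z = (dist v0 x).+1 by [].
rewrite -!card_sep; have -> : sep v0 z = C |: sep v0 x.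
  apply/setP=> D; rewrite (sepE x) zE in_set1 in_setU1.
  by case: eqP => [->|]; rewrite ?(negPf Cv) ?addbF.
by rewrite cardsU1 Cv.
Qed.

(** The cube sends a subset of the ladder set to the vertex separated from [x] by exactly this
    subset, which [ladder_vertex] provides. *)
Lemma ladder_hypercube v0 x y : x \in interval e v0 y ->
  exists t, hypercube_between e v0 x t (ladder_set e x y).
Proof.
move=> xI; set L := ladder_set e x y.
(* [is_hypercube] takes its dimension in ['I_#|V|]; the bound holds because the ladder set has at
   most [dist x y] classes. *)
have lt_L : #|L| < #|V|.
  apply: leq_ltn_trans (subset_leq_card (ladder_sub x y)) _.
  by rewrite card_sep dist_lt_card.
pose val_L : 'I_#|L| -> {set {set V}} := enum_val.
have val_inj : injective val_L := enum_val_inj.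
have val_LT : [set val_L i | i : 'I_#|L|] = L.
  apply/setP=> C; apply/imsetP/idP => [[i _ ->]|CL]; first exact: enum_valP.
  by exists (enum_rank_in CL C); rewrite // /val_L enum_rankK_in.
have val_sub (A : {set 'I_#|L|}) : val_L @: A \subset L.
  by apply/subsetP=> C /imsetP[i _ ->]; apply: enum_valP.
(* By [ladder_vertex] the [pick] succeeds, so the default [x] is never returned. *)
pose F := [ffun A : {set 'I_#|L|} => odflt x [pick w | sep x w == val_L @: A]].
have FE A : sep x (F A) = val_L @: A.
  rewrite ffunE; case: pickP => [w /eqP //|no].
  have [|w wE] := @ladder_vertex x y (val_L @: A); last by have := no w; rewrite wE eqxx.
  exact: val_sub.
have sepF A B : sep (F A) (F B) = val_L @: symdiff A B.
  by rewrite (sep_symdiff x) !FE imsetU !imset_setD.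
have F_inj : injective F.
  by move=> A B AB; apply: (imset_inj val_inj); rewrite -!FE AB.
have F_edge A B : e (F A) (F B) = (#|symdiff A B| == 1).
  by rewrite -dist_edge -card_sep sepF card_imset.
have F0 : F set0 = x by apply/esym/eqP; rewrite -sep_eq0 FE imset0.
(* No class of [L] separates [v0] from [x], so distances from [v0] grow with [#|A|]: [set0] gives
   the basis and [setT] the anti-basis. *)
have distF A : dist v0 (F A) = dist v0 x + #|A|.
  rewrite -(card_imset _ val_inj) -FE card_sep; apply/esym/eqP.
  rewrite -intervalE interval_disjoint; apply: disjointWr (_ : [disjoint _ & sep x y]).
    by apply: subset_trans (ladder_sub x y); rewrite FE val_sub.
  by rewrite -interval_disjoint.
exists (F setT); apply/existsP; exists [set F A | A : {set 'I_#|L|}]; apply/and4P; split.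
- apply/existsP; exists (Ordinal lt_L); apply/existsP; exists F; rewrite eqxx /=.
  apply/andP; split; first exact/injectiveP.
  by apply/forallP=> A; apply/forallP=> B; rewrite F_edge.
- rewrite -F0; apply/andP; split; first exact: imset_f.
  by apply/forall_inP=> _ /imsetP[A _ ->]; rewrite !distF cards0 leq_add2l.
- apply/andP; split; first exact: imset_f.
  by apply/forall_inP=> _ /imsetP[A _ ->]; rewrite !distF leq_add2l subset_leq_card ?subsetT.
rewrite classes_of_cube //; apply/eqP; rewrite -[RHS]val_LT.
apply: eq_imset => i; apply: set1_inj.
have i0 : i \notin set0 by rewrite in_set0.
by rewrite -(sep_cubeU1 F_inj F_edge i0) setU0 F0 FE imset_set1.
Qed.

(** * Milestones *)

Lemma next_milestone_hypercube v0 x y : x \in interval e v0 y ->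
  hypercube_between e v0 x (next_milestone e v0 x y) (ladder_set e x y).
Proof.
move=> /ladder_hypercube[t xt]; rewrite /next_milestone /antibasis_from.
by case: pickP => [//|/(_ t)]; rewrite xt.
Qed.

Lemma ladder_neq0 x y : x != y -> exists C, C \in ladder_set e x y.
Proof.
have [[|z p] [/= pp lp sp]] := geodesic x y; first by rewrite lp eqxx.
case/andP: pp => xz pz _; exists (theta_class e [set x; z]).
have Cs : theta_class e [set x; z] \in sep x y.
  suff /subsetP : sep x z \subset sep x y by apply; rewrite sep_edge ?set11.
  rewrite -interval_sub intervalE -sp; move: (xz); rewrite -dist_edge => /eqP d1.
  have := dist_path pz; have := dist_triangle z x y; rewrite lp -sp d1; lia.
move: Cs; rewrite !inE => /andP[-> ->] /=.
by apply/existsP; exists z; rewrite xz theta_class_in.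
Qed.

(** The step crosses a nonempty set of classes, all of which separate [x] from [y], so it follows a
    geodesic to [y]. *)
Lemma next_milestone_closer v0 x y : x \in interval e v0 y -> x != y ->
  next_milestone e v0 x y \in interval e v0 y /\
  dist (next_milestone e v0 x y) y < dist x y.
Proof.
move=> xI nxy; have [E _ _] := hypercube_between_sep (next_milestone_hypercube xI).
set t := next_milestone e v0 x y in E *.
have tI : t \in interval e x y by rewrite interval_sub E ladder_sub.
have [C CL] := ladder_neq0 nxy; split; last first.
  move: tI; rewrite intervalE => /eqP <-.
  by rewrite -[X in X < _]add0n ltn_add2r -card_sep E; apply/card_gt0P; exists C.
rewrite interval_sub; apply/subsetP=> D; rewrite (sepE x).
move: (xI); rewrite interval_sub => /subsetP /(_ D) vx.
move: tI; rewrite interval_sub => /subsetP /(_ D) xt.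
have := @interval_disjoint_notin v0 x y D xI; move: vx xt.
rewrite (sepE x v0 y); case: (D \in sep v0 x); case: (D \in sep x t);
  by case: (D \in sep x y) => // h1 h2 h3; first [move: (h1 isT) | move: (h2 isT)].
Qed.

Lemma milestones_rec_start v0 n x y : x \in milestones_rec e v0 n x y.
Proof. by case: n => [|n] /=; [|case: ifP => _]; rewrite !inE eqxx. Qed.

(** Distances to [y] strictly decrease along the milestones, so the last one before [y] is the only
    closest one. The clause [dist p y <= dist x y] lets the induction compare [p] with the milestone
    added in front. *)
Lemma milestones_rec_penultimate v0 n x y : x \in interval e v0 y -> x != y ->
  dist x y <= n ->
  exists p, [/\ p \in milestones_rec e v0 n x y, p != y, p \in interval e v0 y,
    next_milestone e v0 p y = y & dist p y <= dist x y /\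
    forall z, z \in milestones_rec e v0 n x y -> z != y -> z != p -> dist p y < dist z y].
Proof.
elim: n x => [|n IH] x xI nxy; first by rewrite leqn0 dist_eq0 (negPf nxy).
move=> le_n; have [tI lt_t] := next_milestone_closer xI nxy => /=.
case: (eqVneq (next_milestone e v0 x y) y) => [E|nty].
  exists x; split=> //; first by rewrite set21.
  by split=> // z /set2P[] ->; rewrite eqxx.
have [|p [pM npy pI pE [le_p pmin]]] := IH _ tI nty; first by lia.
exists p; split=> //; first by rewrite in_setU1 pM orbT.
split=> [|z]; first by lia.
by rewrite in_setU1 => /orP[/eqP -> _ _|]; [lia | apply: pmin].
Qed.

Lemma penultimate_milestoneP v0 x y : x \in interval e v0 y -> x != y ->
  penultimate_milestone e v0 x y \in interval e v0 y /\
  next_milestone e v0 (penultimate_milestone e v0 x y) y = y.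
Proof.
move=> xI nxy.
have [p [pM npy pI pE [_ pmin]]] := milestones_rec_penultimate xI nxy (leqnn _).
suff -> : penultimate_milestone e v0 x y = p by [].
rewrite /penultimate_milestone; case: arg_minnP => [|z].
  by rewrite in_setD1 nxy milestones_rec_start.
(* Strict minimality of [p] forces the selected minimizer [z] to be [p]. *)
rewrite in_setD1 => /andP[nzy zM] /(_ p); rewrite in_setD1 npy pM => /(_ isT) le_z.
by apply/eqP/negPn/negP => /(pmin _ zM nzy); rewrite ltnNge le_z.
Qed.

Lemma hypercube_between_ingoing v0 x y L : hypercube_between e v0 x y L ->
  ingoing e v0 L y.
Proof.
case/hypercube_between_sep=> _ _ H; apply/forall_inP=> C /H[z [zy zC lt_z]].
by apply/existsP; exists z; rewrite zy zC.
Qed.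

Lemma basis_into_hypercube v0 x y L : hypercube_between e v0 x y L ->
  basis_into e v0 y L = x.
Proof.
move=> H; rewrite /basis_into; case: pickP => [z /= Hz|/(_ x)]; last by rewrite H.
exact: hypercube_between_basis_inj Hz H.
Qed.

End Graph.

Theorem theorem9 (V : finType) (e : rel V) (v0 : V)
  (hG : median_graph e) (u : V) :
  ecc e u =
    maxn (\max_(L : {set {set {set V}}} | is_pof e L && outgoing e v0 L u)
            phi e v0 u L)
         (\max_(X : {set {set {set V}}} | is_pof e X && ingoing e v0 X u)
            psi e v0 u X).
Proof.
apply/eqP; rewrite eqn_leq geq_max; apply/and3P; split; last first.
- by apply/bigmax_leqP => X _; apply/bigmax_leqP => v _; apply: leq_bigmax.
- by apply/bigmax_leqP => L _; apply/bigmax_leqP => v _; apply: leq_bigmax.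
apply/bigmax_leqP => v _; rewrite leq_max; apply/orP.
have [_ mv mu] := median_in hG u v v0.
case: (eqVneq (median e u v v0) u) => [E|nmu]; [left|right].
  have uI : u \in interval e v0 v by rewrite interval_sym // -{1}E.
  apply: (@bigmax_sup _ (ladder_set e u v)); first by rewrite ladder_pof ?ladder_outgoing.
  by apply: bigmax_sup (leqnn _); rewrite uI eqxx.
have [pI pE] := penultimate_milestoneP hG mu nmu.
set p := penultimate_milestone _ _ _ _ in pI pE *.
(* Since the next milestone after [p] is [u], the hypercube at [p] with classes [ladder_set e p u]
   has anti-basis [u]; so these classes are ingoing to [u] and [basis_into] returns [p]. *)
have := next_milestone_hypercube hG pI; rewrite pE => H.
apply: (@bigmax_sup _ (ladder_set e p u)).
  by rewrite (ladder_pof hG) (hypercube_between_ingoing hG H).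
by apply: bigmax_sup (leqnn _); rewrite nmu (basis_into_hypercube hG H) eqxx.
Qed.
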